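(* Let $n\ge 3$ be fixed. Then $$|\{\pi\in\mathfrak{S}_n:\mathcal{S}^k(\pi)=\mathrm{id}\}|\;\le\;|\{\pi\in\mathfrak{S}_n:\mathcal{T}^k(\pi)=\mathrm{id}\}|$$ for $k=0,1,2,n-3,n-2$ and $n-1$. Moreover, the inequality is strict for all of these pairs $(n,k)$ that satisfy $2<k<n-1$.
   Context: $\mathfrak{S}_n$ is the set of permutations of $\{1,\ldots,n\}$, written as words; $\mathrm{id}=12\cdots n$. The operators $\mathcal{S}$ (stack sort) and $\mathcal{T}$ (revstack sort) are defined recursively on finite words of distinct positive integers: both fix the empty word and words of length 1, and $\mathcal{S}(LmR)=\mathcal{S}(L)\,\mathcal{S}(R)\,m$, $\mathcal{T}(LmR)=\mathcal{T}(R)\,\mathcal{T}(L)\,m$, where $m$ is the largest entry of $LmR$. $\mathcal{S}^k,\mathcal{T}^k$ are $k$-fold iterates (the identity map for $k=0$). *)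

(* Defs.v *)
From mathcomp Require Import all_boot all_fingroup.
Set Implicit Arguments.
Unset Strict Implicit.
Unset Printing Implicit Defensive.

Definition max_entry (w : seq nat) : nat := foldr maxn 0 w.

(** [decompose_sort combine fuel w] writes a nonempty [w] as [L ++ m :: R],
    with [m] its largest entry, applies itself to [L] and to [R], joins the
    results with [combine] and puts [m] last.  The recursion is not structural,
    so it is driven by [fuel]; any [fuel >= size w] gives the same result. *)
Fixpoint decompose_sort (combine : seq nat -> seq nat -> seq nat)
    (fuel : nat) (w : seq nat) : seq nat :=
  if fuel is f.+1 then
    if w is [::] then [::] else
    let m := max_entry w in
    let i := index m w in
    rcons (combine (decompose_sort combine f (take i w))
                   (decompose_sort combine f (drop i.+1 w))) m
  else [::].

Definition stack_sort (w : seq nat) : seq nat :=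
  decompose_sort (fun sL sR => sL ++ sR) (size w) w.

Definition revstack_sort (w : seq nat) : seq nat :=
  decompose_sort (fun tL tR => tR ++ tL) (size w) w.

(** The one-line notation of [p], with the letters of ['I_n] shifted
    from [{0, ..., n-1}] to [{1, ..., n}]. *)
Definition perm_word (n : nat) (p : 'S_n) : seq nat :=
  [seq (p i).+1 | i <- enum 'I_n].

(** [iota 1 n] is the identity word [1 2 ... n]. *)
Definition sorted_after (f : seq nat -> seq nat) (n k : nat) : {set 'S_n} :=
  [set p : 'S_n | iter k f (perm_word p) == iota 1 n].

Lemma perm_word1 n : perm_word (1%g : 'S_n) = iota 1 n.
Proof.
rewrite /perm_word (eq_map (g := S \o val)); last by move=> i; rewrite perm1.
by rewrite map_comp val_enum_ord -(iotaDl 1 0 n).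
Qed.

Lemma max_entry_mem (x : nat) (w : seq nat) : max_entry (x :: w) \in x :: w.
Proof.
elim: w x => [|y w IH] x; first by rewrite /= maxn0 mem_head.
rewrite -[max_entry _]/(maxn x (max_entry (y :: w))).
by case: leqP => _; rewrite ?mem_head // inE IH orbT.
Qed.

Lemma decompose_sort_cons c f (x : nat) (w : seq nat) (s := x :: w)
    (m := max_entry s) (i := index m s) :
  decompose_sort c f.+1 s =
  rcons (c (decompose_sort c f (take i s))
           (decompose_sort c f (drop i.+1 s))) m.
Proof. by []. Qed.

Lemma decompose_sort_fuel c f g w : size w <= f -> size w <= g ->
  decompose_sort c f w = decompose_sort c g w.
Proof.
elim: f g w => [|f IH] [|g] [|x w] // wf wg.
have lt_i := max_entry_mem x w; rewrite -index_mem in lt_i.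
rewrite !decompose_sort_cons; congr (rcons (c _ _) _); apply: IH.
- by rewrite (size_takel (ltnW lt_i)) -ltnS (leq_trans lt_i).
- by rewrite (size_takel (ltnW lt_i)) -ltnS (leq_trans lt_i).
- by rewrite size_drop subSS (leq_trans (leq_subr _ _)).
- by rewrite size_drop subSS (leq_trans (leq_subr _ _)).
Qed.

Lemma max_entry_cat (m : nat) (L R : seq nat) :
  all (fun x => x < m) (L ++ R) -> max_entry (L ++ m :: R) = m.
Proof.
rewrite all_cat => /andP[]; elim: L => [|x L IH] /=.
  move=> _; elim: R => [|y R IH] /=; first by rewrite maxn0.
  by case/andP=> ym /IH e; rewrite maxnCA e; apply/maxn_idPr/ltnW.
by case/andP=> xm aL aR; rewrite IH //; apply/maxn_idPr/ltnW.
Qed.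

Lemma decompose_sort_cat c (m : nat) (L R : seq nat) :
  all (fun x => x < m) (L ++ R) ->
  decompose_sort c (size (L ++ m :: R)) (L ++ m :: R) =
  rcons (c (decompose_sort c (size L) L) (decompose_sort c (size R) R)) m.
Proof.
move=> lt_m; have mL : m \notin L.
  apply/negP=> mL; have := allP lt_m m; rewrite mem_cat mL ltnn; exact/implyP.
have e : index m (L ++ m :: R) = size L.
  by rewrite index_cat (negPf mL) /= eqxx addn0.
have me := max_entry_cat lt_m.
have sz : size (L ++ m :: R) = (size L + size R).+1 by rewrite size_cat addnS.
have tk : take (size L) (L ++ m :: R) = L by rewrite take_size_cat.
have dr : drop (size L).+1 (L ++ m :: R) = R.
  by rewrite -cat_rcons drop_size_cat // size_rcons.
have -> : decompose_sort c (size (L ++ m :: R)) (L ++ m :: R) =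
    rcons (c (decompose_sort c (size L + size R) L)
             (decompose_sort c (size L + size R) R)) m.
  rewrite sz; case: (L ++ m :: R) sz me e tk dr => [|x w] // _ me e tk dr.
  by rewrite decompose_sort_cons me e tk dr.
by congr (rcons (c _ _) _); apply: decompose_sort_fuel;
   rewrite ?leq_addr ?leq_addl.
Qed.

Lemma stack_sort_nil : stack_sort [::] = [::].
Proof. by []. Qed.

Lemma stack_sort_cat (m : nat) (L R : seq nat) :
  all (fun x => x < m) (L ++ R) ->
  stack_sort (L ++ m :: R) = stack_sort L ++ stack_sort R ++ [:: m].
Proof.
by move=> lt_m; rewrite /stack_sort decompose_sort_cat // -cats1 catA.
Qed.

Lemma revstack_sort_nil : revstack_sort [::] = [::].
Proof. by []. Qed.

Lemma revstack_sort_cat (m : nat) (L R : seq nat) :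
  all (fun x => x < m) (L ++ R) ->
  revstack_sort (L ++ m :: R) = revstack_sort R ++ revstack_sort L ++ [:: m].
Proof.
by move=> lt_m; rewrite /revstack_sort decompose_sort_cat // -cats1 catA.
Qed.

(* Main.v *)
Require Import Defs.
From mathcomp Require Import all_boot all_fingroup.
From mathcomp Require Import zify.

(** Write [S] for stack sort and [T] for revstack sort.  A reversal exchanges
    them, [T w = S (rev w)], which settles [k <= 1].

    [k = 2].  What [S] does to a word depends only on the positions of the
    maxima of its factors.  Given [w] with [S (S w) = id], relabel every letter
    by its rank in [T (S w)].  In the decreasing tree of [S w] a letter comes
    after its descendants in [T (S w)], so the relabelling keeps the maxima of
    the factors of [S w]; hence it commutes with [S] on [w], and with [S] and
    [T] on [S w].  The relabelled word [v] thus has [T (S v) = id], that is,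
    [T (T (rev v)) = id].  Nothing is lost: [S (S v)] is the image of the
    identity word, so it lists the values of the relabelling.  This is an
    injection between the two sets of words (lemma [word_count_sorted2]).

    [k = n - 1].  After [j] passes of [T] the [j] largest letters are in place,
    so [T^(n-1)] sorts everything.

    [k = n - 2] and [k = n - 3].  Here the unsorted words are compared.
    - Under [S] there are many.  If a letter [a], followed by larger letters
      only, comes right after the maximum of what precedes it, one pass moves
      it over a single larger letter and the situation recurs
      ([delayed_stack_sort]).  Words in which this happens, from the start or
      from the first pass on, number at least [(n-2)!] for [k = n - 2], and more
      than [4 (n-2)!] for [k = n - 3].
    - Under [T] there are few.  Both parts of [T (L n R) = T R ++ T L ++ [n]]
      end with their maxima, so if [T R ++ T L = A m B] with [m] the maximum
      and [B] nonempty, then [T R = A m] and [T L = B] are forced.  By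
      induction, a word [L n R] left unsorted by [n - 2] passes has in [L] the
      letters of the parity of [n] and in [R] the others
      ([parity_split_unsorted]), which leaves at most [2 (n-3)!] words
      if [n >= 5].  For
      [n - 3] passes there is one degree of freedom more: either the letters of
      [L] form one of [n] sets, or deleting [n] gives a word of the
      previous shape ([near_split_unsorted]); this leaves at most [4 (n-2)!]
      words as soon as [n >= 6].
    The remaining small [n] have [k <= 2]. *)

(** * Words and their number *)

Definition word_count (n : nat) (Q : pred (seq nat)) : nat :=
  count Q (permutations (iota 1 n)).

Lemma perm_word_perm n (p : 'S_n) : perm_eq (perm_word p) (iota 1 n).
Proof.
rewrite -(perm_word1 n) /perm_word.
rewrite (eq_map (g := (fun i : 'I_n => i.+1) \o p)) // map_comp.
rewrite (eq_map (f := fun i : 'I_n => ((1%g : 'S_n) i).+1)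
  (g := fun i : 'I_n => i.+1)); last by move=> i; rewrite perm1.
apply: perm_map; apply: uniq_perm; rewrite ?(map_inj_uniq perm_inj) ?enum_uniq //.
move=> i; rewrite mem_enum -[i in LHS](permKV p) mem_map ?mem_enum //.
exact: perm_inj.
Qed.

Lemma perm_word_inj n : injective (@perm_word n).
Proof.
move=> p q /eq_in_map e; apply/permP => i; apply: val_inj.
by have /succn_inj := e i (mem_enum _ i).
Qed.

Lemma card_word_count n (Q : pred (seq nat)) :
  #|[set p : 'S_n | Q (perm_word p)]| = word_count n Q.
Proof.
have pw : perm_eq [seq perm_word p | p : 'S_n] (permutations (iota 1 n)).
  have u : uniq [seq perm_word p | p : 'S_n].
    by rewrite (map_inj_uniq (@perm_word_inj n)) enum_uniq.
  have sub : {subset [seq perm_word p | p : 'S_n] <= permutations (iota 1 n)}.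
    by move=> w /mapP[p _ ->]; rewrite mem_permutations perm_word_perm.
  apply: uniq_perm; rewrite ?permutations_uniq //.
  apply: (uniq_min_size u sub _).2.
  by rewrite size_permutations ?iota_uniq // size_iota size_map -cardE card_Sn.
rewrite /word_count -(seq.permP pw) count_map cardE.
rewrite /enum_mem size_filter count_filter; apply: eq_count => p.
by rewrite /= inE andbT.
Qed.

Lemma word_uniq n w : perm_eq w (iota 1 n) -> uniq w.
Proof. by move/perm_uniq->; exact: iota_uniq. Qed.

Lemma word_countC n Q : word_count n Q + word_count n (predC Q) = n`!.
Proof.
by rewrite count_predC size_permutations ?iota_uniq // size_iota.
Qed.

Lemma leq_word_count n (Q1 Q2 : pred (seq nat)) (f : seq nat -> seq nat) :
  (forall w, perm_eq w (iota 1 n) -> Q1 w ->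
     perm_eq (f w) (iota 1 n) /\ Q2 (f w)) ->
  (forall w1 w2, perm_eq w1 (iota 1 n) -> perm_eq w2 (iota 1 n) ->
     Q1 w1 -> Q1 w2 -> f w1 = f w2 -> w1 = w2) ->
  word_count n Q1 <= word_count n Q2.
Proof.
move=> fQ f_inj; rewrite /word_count -!size_filter -(size_map f).
apply: uniq_leq_size => [|w].
  rewrite map_inj_in_uniq ?filter_uniq ?permutations_uniq // => w1 w2.
  by rewrite !mem_filter !mem_permutations => /andP[? ?] /andP[? ?]; apply: f_inj.
case/mapP => v; rewrite mem_filter mem_permutations => /andP[Qv pv] ->.
by rewrite mem_filter mem_permutations; case: (fQ v pv Qv) => -> ->.
Qed.

Lemma word_count_le_size n (Q : pred (seq nat)) (s : seq (seq nat)) :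
  (forall w, perm_eq w (iota 1 n) -> Q w -> w \in s) ->
  word_count n Q <= size s.
Proof.
move=> Qs; rewrite /word_count -size_filter.
apply: uniq_leq_size; first by rewrite filter_uniq ?permutations_uniq.
by move=> w; rewrite mem_filter mem_permutations => /andP[Qw /Qs->].
Qed.

Lemma size_le_word_count n (Q : pred (seq nat)) (s : seq (seq nat)) :
  uniq s -> (forall w, w \in s -> perm_eq w (iota 1 n) /\ Q w) ->
  size s <= word_count n Q.
Proof.
move=> us sQ; rewrite /word_count -size_filter.
by apply: uniq_leq_size => // w /sQ[pw Qw]; rewrite mem_filter mem_permutations Qw.
Qed.

(** * The decomposition of a word at its largest letter *)

Lemma cat_cons_inj {T : eqType} {x : T} {a b c d : seq T} :
  x \notin a -> x \notin c -> a ++ x :: b = c ++ x :: d -> a = c /\ b = d.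
Proof.
elim: a c => [|y a IH] [|z c] /=; rewrite ?inE ?negb_or.
- by move=> _ _ [].
- by move=> _ /andP[/eqP xz _] [].
- by move=> /andP[/eqP xy _] _ [e]; case: xy.
- by move=> /andP[_ xa] /andP[_ xc] [-> /(IH c xa xc)[-> ->]].
Qed.

Lemma uniq_split (L R : seq nat) m :
  uniq (L ++ m :: R) = (m \notin L ++ R) && uniq (L ++ R).
Proof. by rewrite -(cat1s m R) uniq_catCA. Qed.

Lemma uniq_cat_cons_inj {x : nat} {a b c d : seq nat} : uniq (a ++ x :: b) ->
  a ++ x :: b = c ++ x :: d -> a = c /\ b = d.
Proof.
move=> u e; apply: (cat_cons_inj _ _ e).
  by move: u; rewrite uniq_split mem_cat negb_or => /andP[/andP[]].
by move: u; rewrite e uniq_split mem_cat negb_or => /andP[/andP[]].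
Qed.

Lemma uniq_sides {L R : seq nat} {m} : uniq (L ++ m :: R) -> uniq L /\ uniq R.
Proof. by rewrite cat_uniq /= => /and3P[-> _ /andP[_ ->]]. Qed.

Lemma max_split (w : seq nat) : uniq w -> w != [::] ->
  exists L m R, w = L ++ m :: R /\ all (fun x => x < m) (L ++ R).
Proof.
case: w => // x w u _; have := max_entry_mem x w.
have le : forall y, y \in x :: w -> y <= max_entry (x :: w).
  elim: (x :: w) => //= z v IH y; rewrite inE => /orP[/eqP->|/IH h].
    exact: leq_maxl.
  exact: leq_trans h (leq_maxr _ _).
set m := max_entry _ in le * => /splitPr mw; case: mw u le => L R u le.
exists L, m, R; split=> //; apply/allP => y yLR.
have : y \in L ++ m :: R by rewrite mem_cat inE orbCA -mem_cat yLR orbT.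
move/le; rewrite leq_eqVlt => /orP[/eqP e|//].
by move: u; rewrite uniq_split -e yLR.
Qed.

(** Induction along the recursion that defines both sorting operators. *)
Lemma word_ind (P : seq nat -> Prop) :
  P [::] ->
  (forall L m R, all (fun x => x < m) (L ++ R) -> uniq (L ++ m :: R) ->
     P L -> P R -> P (L ++ m :: R)) ->
  forall w : seq nat, uniq w -> P w.
Proof.
move=> P0 PS w; have [k] := ubnP (size w); elim: k w => // k IH w lt_k u.
have [->//|w0] := eqVneq w [::].
have [L [m [R [e lt_m]]]] := max_split _ u w0.
move: u lt_k; rewrite e => u; rewrite size_cat /= => lt_k.
have : uniq (L ++ R) by move: u; rewrite uniq_split => /andP[].
rewrite cat_uniq => /and3P[uL _ uR].
by apply: PS => //; apply: IH => //; lia.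
Qed.

Lemma perm_stack_sort w : uniq w -> perm_eq (stack_sort w) w.
Proof.
move: w; apply: word_ind => // L m R lt_m _ pL pR.
by rewrite stack_sort_cat // perm_cat // cats1 perm_rcons perm_cons.
Qed.

Lemma revstack_sort_rev w : uniq w -> revstack_sort w = stack_sort (rev w).
Proof.
move: w; apply: word_ind => // L m R lt_m _ eL eR.
rewrite revstack_sort_cat // eL eR rev_cat rev_cons cat_rcons stack_sort_cat //.
by rewrite -rev_cat all_rev; move: lt_m; rewrite !all_cat andbC.
Qed.

Lemma perm_revstack_sort w : uniq w -> perm_eq (revstack_sort w) w.
Proof.
move=> u; rewrite revstack_sort_rev //.
by apply: (perm_trans (perm_stack_sort _ _)); rewrite ?rev_uniq // perm_rev.
Qed.

Lemma stack_sort_word n w :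
  perm_eq w (iota 1 n) -> perm_eq (stack_sort w) (iota 1 n).
Proof. by move=> pw; exact: perm_trans (perm_stack_sort _ (word_uniq n w pw)) pw. Qed.

Lemma revstack_sort_word n w :
  perm_eq w (iota 1 n) -> perm_eq (revstack_sort w) (iota 1 n).
Proof. by move=> pw; exact: perm_trans (perm_revstack_sort _ (word_uniq n w pw)) pw. Qed.

(** * Sorting with two passes *)

(** The condition under which relabelling by [g] leaves the decreasing tree
    unchanged: the subtrees are factors, and their roots are the maxima. *)
Definition keeps_maxima (g : nat -> nat) (w : seq nat) : Prop :=
  forall a b L m R, w = a ++ (L ++ m :: R) ++ b ->
    all (fun x => x < m) (L ++ R) -> all (fun x => g x < g m) (L ++ R).

Lemma keeps_maxima_infix g a w b :
  keeps_maxima g (a ++ w ++ b) -> keeps_maxima g w.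
Proof.
move=> gw a' b' L m R e; apply: (gw (a ++ a') (b' ++ b)).
by rewrite e -!catA.
Qed.

Lemma keeps_maxima_rev g w : keeps_maxima g w -> keeps_maxima g (rev w).
Proof.
move=> gw a b L m R e lt_m.
have := gw (rev b) (rev a) (rev R) m (rev L).
rewrite -{1}(revK w) e !rev_cat rev_cons cat_rcons -!catA !all_cat !all_rev.
rewrite !(andbC (all _ R)) => H; apply: H => //.
by move: lt_m; rewrite all_cat.
Qed.

Lemma stack_sort_map g w : uniq w ->
  keeps_maxima g w -> stack_sort (map g w) = map g (stack_sort w).
Proof.
move: w; apply: word_ind => // L m R lt_m _ IL IR gw.
have lt_gm : all (fun x => g x < g m) (L ++ R).
  by apply: (gw [::] [::]) => //; rewrite cats0.
rewrite map_cat /= !stack_sort_cat -?map_cat ?all_map //.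
rewrite IL ?IR ?map_cat //.
  by apply: (@keeps_maxima_infix g (rcons L m) R [::]); rewrite cats0 cat_rcons.
exact: (@keeps_maxima_infix g [::] L (m :: R)).
Qed.

Lemma revstack_sort_map g w : uniq w -> uniq (map g w) ->
  keeps_maxima g w -> revstack_sort (map g w) = map g (revstack_sort w).
Proof.
move=> u gu gw; rewrite !revstack_sort_rev // -map_rev stack_sort_map ?rev_uniq //.
exact: keeps_maxima_rev.
Qed.

(** The hypothesis on the sorted word suffices: the letters of a subtree of [w]
    form a factor of [stack_sort w] that ends with the root of that subtree. *)
Lemma stack_sort_map_sorted g w : uniq w ->
  keeps_maxima g (stack_sort w) -> stack_sort (map g w) = map g (stack_sort w).
Proof.
move: w; apply: word_ind => // L m R lt_m u IL IR.
rewrite stack_sort_cat // => gw.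
have uLR : uniq (L ++ R) by move: u; rewrite uniq_split => /andP[].
have [uL uR] : uniq L /\ uniq R by move: uLR; rewrite cat_uniq => /and3P[].
have pLR : perm_eq (stack_sort L ++ stack_sort R) (L ++ R).
  by rewrite perm_cat ?perm_stack_sort.
have lt_gm : all (fun x => g x < g m) (L ++ R).
  rewrite -(perm_all _ pLR) -(cats0 (_ ++ _)); apply: (gw [::] [::]).
    by rewrite cats0 /= -catA.
  by rewrite cats0 (perm_all _ pLR).
rewrite map_cat /= !stack_sort_cat -?map_cat ?all_map //.
rewrite IL ?IR ?map_cat //.
  exact: (@keeps_maxima_infix g (stack_sort L) _ [:: m]).
exact: (@keeps_maxima_infix g [::] _ (stack_sort R ++ [:: m])).
Qed.

(** Revstack sort reads the decreasing tree so that each letter comes after all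
    of its descendants, and all letters of a factor descend from its maximum. *)
Lemma keeps_maxima_index w : uniq w ->
  keeps_maxima (index^~ (revstack_sort w)) w.
Proof.
move: w; apply: word_ind => [|L0 M R0 lt_M u IL IR] a b L m R.
  by case: a L => [|? ?] [|? ?].
have [M_LR u_LR] : M \notin L0 ++ R0 /\ uniq (L0 ++ R0).
  by move: u; rewrite uniq_split => /andP[].
have [uL [uLR uR]] : uniq L0 /\ ~~ has (mem L0) R0 /\ uniq R0.
  by move: u_LR; rewrite cat_uniq => /and3P[].
have pT : perm_eq (revstack_sort R0 ++ revstack_sort L0) (L0 ++ R0).
  by rewrite perm_catC perm_cat ?perm_revstack_sort.
move=> e lt_m; rewrite revstack_sort_cat // catA.
have [s sE] : exists s, s = L ++ m :: R by eexists.
rewrite -sE in e.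
have mem_s x : x \in L ++ R -> x \in s.
  by rewrite sE !mem_cat inE => /orP[]->; rewrite ?orbT.
have m_s : m \in s by rewrite sE mem_cat mem_head orbT.
have index_R x y : x \in R0 -> y \in R0 ->
    index x (revstack_sort R0) < index y (revstack_sort R0) ->
    index x ((revstack_sort R0 ++ revstack_sort L0) ++ [:: M]) <
    index y ((revstack_sort R0 ++ revstack_sort L0) ++ [:: M]).
  move=> xR yR; rewrite -catA !index_cat.
  by rewrite !(perm_mem (perm_revstack_sort _ uR)) xR yR.
have index_L x y : x \in L0 -> y \in L0 ->
    index x (revstack_sort L0) < index y (revstack_sort L0) ->
    index x ((revstack_sort R0 ++ revstack_sort L0) ++ [:: M]) <
    index y ((revstack_sort R0 ++ revstack_sort L0) ++ [:: M]).
  move=> xL yL; rewrite -catA !index_cat.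
  rewrite !(perm_mem (perm_revstack_sort _ uR)).
  rewrite !(perm_mem (perm_revstack_sort _ uL)) xL yL.
  have nR z : z \in L0 -> (z \in R0) = false.
    by move=> zL; apply: contraNF uLR => zR; apply/hasP; exists z.
  by rewrite !nR // ltn_add2l.
have: M \in a ++ s ++ b by rewrite -e mem_cat mem_head orbT.
move: (M_LR); rewrite mem_cat negb_or => /andP[ML MR].
rewrite !mem_cat => /or3P[] Ms.
- case/splitPr: Ms e => a1 a2 e.
  have M_a1 : M \notin a1.
    by move: u; rewrite e -catA uniq_split mem_cat negb_or => /andP[/andP[]].
  have e1 : L0 ++ M :: R0 = a1 ++ M :: (a2 ++ s ++ b) by rewrite e -!catA.
  have [_ eR] := cat_cons_inj ML M_a1 e1.
  have R0s x : x \in s -> x \in R0 by move=> xs; rewrite eR !mem_cat xs orbT.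
  apply/allP=> x xLR; apply: index_R; rewrite ?R0s ?m_s ?mem_s //.
  by rewrite sE in eR; have := allP (IR _ _ _ _ _ eR lt_m) x xLR.
- have Mm : M = m.
    apply/eqP; move: Ms; rewrite sE mem_cat inE orbCA -mem_cat.
    case/orP=> // /(allP lt_m) ltMm.
    have : m \in L0 ++ M :: R0 by rewrite e !mem_cat m_s orbT.
    rewrite mem_cat inE orbCA -mem_cat => /orP[/eqP->|/(allP lt_M)] //.
    by lia.
  move: e; rewrite sE -catA catA cat_cons -Mm => e.
  have M_aL : M \notin a ++ L.
    by move: u; rewrite e uniq_split mem_cat negb_or => /andP[/andP[]].
  have [eL eR] := cat_cons_inj ML M_aL e.
  have sLR x : x \in L ++ R -> x \in revstack_sort R0 ++ revstack_sort L0.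
    rewrite (perm_mem pT) eL eR !mem_cat => /orP[]->; by rewrite ?orbT.
  apply/allP=> x /sLR xLR; rewrite [X in _ < X]index_cat (perm_mem pT) (negPf M_LR).
  by rewrite index_cat xLR /= eqxx addn0 index_mem.
- case/splitPr: Ms e => b1 b2 e.
  have M_asb : M \notin a ++ s ++ b1.
    move: u; rewrite e !catA uniq_split mem_cat negb_or -!catA.
    by case/andP=> /andP[].
  have [eL _] : L0 = a ++ s ++ b1 /\ R0 = b2.
    by apply: (@cat_cons_inj _ M); rewrite // e -!catA.
  have L0s x : x \in s -> x \in L0.
    by move=> xs; rewrite eL !mem_cat xs orbT.
  apply/allP=> x xLR; apply: index_L; rewrite ?L0s ?m_s ?mem_s //.
  by rewrite sE in eL; have := allP (IL _ _ _ _ _ eL lt_m) x xLR.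
Qed.

Lemma map_index_self (T : eqType) (s : seq T) :
  uniq s -> [seq (index x s).+1 | x <- s] = iota 1 (size s).
Proof.
move=> us; rewrite -(addn0 1) iotaDl map_comp; congr map.
case: s us => // x0 s us; apply: (@eq_from_nth _ 0); rewrite size_map ?size_iota //.
by move=> i lt_i; rewrite (nth_map x0) // index_uniq // nth_iota.
Qed.

(** The relabelling after which [revstack_sort] sorts [stack_sort w]. *)
Definition relabel (w : seq nat) (x : nat) : nat :=
  (index x (revstack_sort (stack_sort w))).+1.

Lemma map_relabel_revstack n w : perm_eq w (iota 1 n) ->
  map (relabel w) (revstack_sort (stack_sort w)) = iota 1 n.
Proof.
move=> pw; have pt := revstack_sort_word n _ (stack_sort_word n w pw).
by rewrite map_index_self ?(word_uniq n) // (perm_size pt) size_iota.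
Qed.

Lemma relabel_inj n w : perm_eq w (iota 1 n) ->
  {in iota 1 n &, injective (relabel w)}.
Proof.
move=> pw x y; have pt := revstack_sort_word n _ (stack_sort_word n w pw).
rewrite -!(perm_mem pt) => xt yt [e].
by rewrite -(nth_index 0 xt) e nth_index.
Qed.

Lemma relabel_word n w v : perm_eq w (iota 1 n) -> perm_eq v (iota 1 n) ->
  perm_eq (map (relabel w) v) (iota 1 n).
Proof.
move=> pw pv; rewrite -(map_relabel_revstack n w pw); apply: perm_map.
rewrite (perm_trans pv) // perm_sym.
exact/revstack_sort_word/stack_sort_word.
Qed.

Lemma keeps_maxima_relabel w : uniq w -> keeps_maxima (relabel w) (stack_sort w).
Proof.
move=> uw a b L m R e lt_m; have us : uniq (stack_sort w).
  by rewrite (perm_uniq (perm_stack_sort w uw)).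
by have := keeps_maxima_index _ us _ _ _ _ _ e lt_m.
Qed.

Lemma stack_sort_relabel n w : perm_eq w (iota 1 n) ->
  stack_sort (map (relabel w) w) = map (relabel w) (stack_sort w).
Proof.
move=> /word_uniq uw.
exact: stack_sort_map_sorted uw (keeps_maxima_relabel w uw).
Qed.

Lemma stack_sort_relabel2 n w : perm_eq w (iota 1 n) ->
  stack_sort (map (relabel w) (stack_sort w)) =
  map (relabel w) (stack_sort (stack_sort w)).
Proof.
move=> pw; apply: stack_sort_map (keeps_maxima_relabel w (word_uniq n w pw)).
exact/(word_uniq n)/stack_sort_word.
Qed.

Lemma revstack_sort_relabel n w : perm_eq w (iota 1 n) ->
  revstack_sort (map (relabel w) (stack_sort w)) = iota 1 n.
Proof.
move=> pw; have ps := stack_sort_word n w pw.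
rewrite revstack_sort_map ?(map_relabel_revstack n) //.
- exact: word_uniq ps.
- exact/(word_uniq n)/relabel_word.
- exact/keeps_maxima_relabel/(word_uniq n).
Qed.

Lemma word_count_sorted1 n :
  word_count n (fun w => stack_sort w == iota 1 n) <=
  word_count n (fun w => revstack_sort w == iota 1 n).
Proof.
apply: (leq_word_count _ _ _ rev) => [w pw sw|w1 w2 _ _ _ _ /(can_inj revK)//].
have u : uniq w by rewrite (perm_uniq pw) iota_uniq.
by rewrite perm_rev revstack_sort_rev ?rev_uniq // revK.
Qed.

(** The relabelled words are reversed because
    [revstack_sort (rev v) = stack_sort v]. *)
Lemma word_count_sorted2 n :
  word_count n (fun w => stack_sort (stack_sort w) == iota 1 n) <=
  word_count n (fun w => revstack_sort (revstack_sort w) == iota 1 n).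
Proof.
apply: (leq_word_count _ _ _ (fun w => rev (map (relabel w) w))).
  move=> w pw _; have pgw := relabel_word n w w pw pw.
  have u := word_uniq n _ pgw.
  rewrite perm_rev; split=> //.
  rewrite (revstack_sort_rev (rev _)) ?rev_uniq // revK.
  by rewrite (stack_sort_relabel n) // (revstack_sort_relabel n).
move=> w1 w2 pw1 pw2 /eqP e1 /eqP e2 /(can_inj revK) e.
(* Sorting twice turns both sides into the image of the identity word, so the
   two relabellings agree on every letter. *)
have := congr1 stack_sort e; rewrite !(stack_sort_relabel n) // => es.
have := congr1 stack_sort es; rewrite !(stack_sort_relabel2 n) // e1 e2.
move/eq_in_map => eg; move: e.
have -> : map (relabel w2) w2 = map (relabel w1) w2.
  by apply/eq_in_map => x; rewrite (perm_mem pw2) => /eg.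
apply: (inj_in_map (relabel_inj n w1 pw1)); rewrite inE.
- by apply/allP => x; rewrite (perm_mem pw1).
- by apply/allP => x; rewrite (perm_mem pw2).
Qed.

(** * Words that stay unsorted under stack sort *)

Lemma uniq_stack_sort w : uniq w -> uniq (stack_sort w).
Proof. by move=> u; rewrite (perm_uniq (perm_stack_sort w u)). Qed.

Lemma stack_sort_last_max w : uniq w -> w != [::] ->
  exists u m, stack_sort w = rcons u m /\ all (fun x => x < m) u.
Proof.
move=> uw w0; have [L [m [R [e lt_m]]]] := max_split w uw w0.
exists (stack_sort L ++ stack_sort R), m; split.
  by rewrite e stack_sort_cat // catA cats1.
move: uw; rewrite e uniq_split cat_uniq => /and4P[_ uL _ uR].
rewrite (perm_all (s2 := L ++ R)) //.
by rewrite perm_cat ?perm_stack_sort.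
Qed.

Lemma stack_sort_cons_min a v : uniq v -> all (fun x => a < x) v ->
  stack_sort (a :: v) = a :: stack_sort v.
Proof.
move: v; apply: word_ind => // L m R lt_m _ IL _.
rewrite all_cat /= => /and3P[aL am aR].
by rewrite (@stack_sort_cat m (a :: L)) /= ?am // IL // stack_sort_cat.
Qed.

(** The letter [a] leaves the stack as soon as the next letter arrives, hence
    before [m] but after everything that precedes [m]. *)
Lemma stack_sort_before u m a v : uniq (u ++ m :: a :: v) ->
  all (fun x => x < m) u -> a < m -> all (fun x => a < x) v ->
  exists2 v', stack_sort (u ++ m :: a :: v) = stack_sort u ++ a :: v' &
    all (fun x => a < x) v'.
Proof.
move=> uw um am; have uv : uniq v.
  by move: uw; rewrite cat_uniq /= => /and3P[_ _ /and3P[_ _]].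
have top v1 : uniq v1 -> all (fun x => x < m) v1 -> all (fun x => a < x) v1 ->
    exists2 v', stack_sort (u ++ m :: a :: v1) = stack_sort u ++ a :: v' &
      all (fun x => a < x) v'.
  move=> uv1 v1m av1; rewrite stack_sort_cat; last by rewrite all_cat /= um am.
  rewrite stack_sort_cons_min //; exists (stack_sort v1 ++ [:: m]) => //.
  by rewrite all_cat (perm_all _ (perm_stack_sort _ uv1)) av1 /= am.
move: v uv uw; apply: word_ind => [_ _|L M R lt_M uLMR IL _ uw av].
  exact: top.
move: (av); rewrite all_cat /= => /and3P[aL aM aR].
have [Mm|mM] := leqP M m.
  have {}Mm : M < m.
    rewrite ltn_neqAle Mm andbT; apply: contraTneq uw => ->.
    by rewrite uniq_split mem_cat inE mem_cat mem_head !orbT.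
  apply: top; rewrite ?uLMR //; move: lt_M; rewrite !all_cat /= Mm => /andP[lL lR].
  by apply/andP; split; [move: lL | move: lR]; apply: sub_all => x /ltn_trans; apply.
have ew : u ++ m :: a :: L ++ M :: R = (u ++ m :: a :: L) ++ M :: R.
  by rewrite -catA.
have u1 : uniq (u ++ m :: a :: L) by move: uw; rewrite ew cat_uniq => /and3P[].
have uR : uniq R by move: uLMR; rewrite cat_uniq /= => /and3P[_ _ /andP[]].
have [v' e av'] := IL u1 aL.
rewrite ew stack_sort_cat.
  exists (v' ++ stack_sort R ++ [:: M]); first by rewrite e -!catA.
  by rewrite !all_cat av' (perm_all _ (perm_stack_sort _ uR)) aR /= aM.
move: lt_M; rewrite !all_cat /= mM (ltn_trans am mM) => /andP[-> ->].
rewrite !andbT; move: um; apply: sub_all => x /ltn_trans; exact.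
Qed.

(** The letter [a] still has to pass [p] letters besides [m]; it passes one
    letter at a time, because the letters before it end with their maximum. *)
Definition delayed (a p : nat) (w : seq nat) : Prop :=
  exists u m v, [/\ w = u ++ m :: a :: v, all (fun x => x < m) u, a < m,
    all (fun x => a < x) v & count (fun x => a < x) u = p].

(** After a pass, [a] is preceded by [stack_sort u], which ends with the maximum
    of [u]; that maximum takes over the role of [m], which has been passed. *)
Lemma delayed_stack_sort a p w : uniq w ->
  delayed a p.+1 w -> delayed a p (stack_sort w).
Proof.
move=> uw [u [m [v [ew um am av cu]]]]; rewrite {w}ew in uw *.
have [v' -> av'] := stack_sort_before u m a v uw um am av.
have uu : uniq u by move: uw; rewrite cat_uniq => /and3P[].
have [|u' [m' [e um']]] := stack_sort_last_max u uu; first by case: (u) cu.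
have := perm_stack_sort u uu; rewrite e => pu.
have := cu; rewrite -(seq.permP pu) -cats1 count_cat /= => cu'.
have am' : a < m'.
  have: has (fun x => a < x) (rcons u' m').
    by rewrite has_count (seq.permP pu) cu.
  rewrite has_rcons => /orP[//|/hasP[x xu' ax]].
  exact: ltn_trans ax (allP um' x xu').
exists u', m', v'; split=> //; first by rewrite cats1 cat_rcons.
by move: cu'; rewrite am' addn0 addn1 => -[].
Qed.

Lemma delayed_iter_stack_sort a k p w : uniq w -> k <= p ->
  delayed a p w -> ~~ sorted ltn (iter k stack_sort w).
Proof.
elim: k p w => [|k IH] p w uw kp dw.
  case: dw => u [m [v [-> _ am _ _]]] /=.
  by apply/negP=> /cat_sorted2[_] /= /andP[]; rewrite ltnNge ltnW.
case: p kp dw => // p kp dw; rewrite iterSr; apply: (IH p) => //.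
  exact: uniq_stack_sort.
exact: delayed_stack_sort.
Qed.

Lemma delayed_unsorted a n k p w : perm_eq w (iota 1 n) -> k <= p ->
  delayed a p w -> iter k stack_sort w != iota 1 n.
Proof.
move=> pw kp dw; have uw : uniq w by rewrite (perm_uniq pw) iota_uniq.
by apply: contraNneq (delayed_iter_stack_sort a k p w uw kp dw) => ->;
   apply: iota_ltn_sorted.
Qed.

(** Many words at once: fixed blocks [u] and [v] are inserted into all the
    arrangements of [base], which keeps these arrangements distinguishable. *)
Definition splice_words (base : seq nat) (k : nat) (u v : seq nat) :=
  [seq take k r ++ u ++ drop k r ++ v | r <- permutations base].

Lemma size_splice_words base k u v : uniq base ->
  size (splice_words base k u v) = (size base)`!.
Proof. by move=> ub; rewrite size_map size_permutations. Qed.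

Lemma splice_words_uniq base k u v : k <= size base ->
  uniq (splice_words base k u v).
Proof.
move=> lek; rewrite map_inj_in_uniq ?permutations_uniq // => r s.
rewrite !mem_permutations => /perm_size sr /perm_size ss /eqP.
rewrite !eqseq_cat ?size_drop ?sr ?ss ?eqxx /=.
- by case/and3P=> /eqP e1 /eqP e2 _; rewrite -(cat_take_drop k r) e1 e2 cat_take_drop.
- by [].
- by [].
- by rewrite !size_take sr ss.
Qed.

Lemma splice_wordsP base k u v w : w \in splice_words base k u v ->
  exists2 r, perm_eq r base & w = take k r ++ u ++ drop k r ++ v.
Proof. by case/mapP=> r; rewrite mem_permutations => pr ->; exists r. Qed.

Lemma perm_splice n base k (u v r : seq nat) :
  perm_eq r base -> perm_eq (u ++ v ++ base) (iota 1 n) ->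
  perm_eq (take k r ++ u ++ drop k r ++ v) (iota 1 n).
Proof.
move=> pr; apply: perm_trans; rewrite perm_catCA perm_cat2l.
rewrite catA perm_catC perm_cat2l cat_take_drop //.
Qed.

Lemma perm_iota_lo_hi n : perm_eq ([:: n.+2; 1] ++ iota 2 n) (iota 1 n.+2).
Proof.
have -> : iota 1 n.+2 = 1 :: iota 2 n ++ [:: n.+2].
  by rewrite -[iota 1 n.+2]/(1 :: iota 2 n.+1) -{1}(addn1 n) iotaD add2n.
by rewrite (perm_catCA [:: n.+2] [:: 1]) /= perm_cons -cat1s perm_catC.
Qed.

(** The letter 1 at the end, right after the largest letter, needs [n.+1] passes
    to reach the front; the other letters are in any order. *)
Lemma unsorted_stack_ge_fact n :
  n`! <= word_count n.+2 (fun w => iter n stack_sort w != iota 1 n.+2).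
Proof.
rewrite -[n in n`!](size_iota 2) -(size_splice_words _ n [:: n.+2; 1] [::]) ?iota_uniq //.
apply: size_le_word_count => [|w /splice_wordsP[r pr ->]].
  by rewrite splice_words_uniq ?size_iota.
have pw := perm_splice n.+2 _ n [:: n.+2; 1] [::] r pr (perm_iota_lo_hi n).
split=> //; apply: (delayed_unsorted 1 n.+2 n n) => //.
have sr := perm_size pr; rewrite size_iota in sr.
rewrite take_oversize ?drop_oversize ?sr //.
exists r, n.+2, [::]; split=> //.
  by rewrite (perm_all _ pr); apply/allP=> x; rewrite mem_iota; lia.
rewrite -sr; apply/eqP; rewrite -all_count (perm_all _ pr).
by apply/allP=> x; rewrite mem_iota; lia.
Qed.

(** Four families of [n.+2`!] words each, and one word more.  Let [r] stand for
    an arbitrary arrangement of the letters that are not shown, and [b] for its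
    last letter.
    - [F3]: [r N 1], where 1 has one step more than necessary;
    - [F1]: [r' N 1 b] with [r = r' b], where 1 starts one place earlier;
    - [F2]: [r' N b 1], where the first pass moves 1 over two letters, after
      which 1 is again preceded by a maximum;
    - [F4]: [r N 2], where the letter 2 is the late one and 1 occurs in [r];
    - [w0]: one word in which 1 comes right after [N - 1], the maximum of its
      prefix, while [N] is already last. *)
Lemma unsorted_stack_gt_fact n (N := n.+4) :
  4 * n.+2`! < word_count N (fun w => iter n.+1 stack_sort w != iota 1 N).
Proof.
pose B := iota 2 n.+2.
pose F1 := splice_words B n.+1 [:: N; 1] [::].
pose F2 := splice_words B n.+1 [:: N] [:: 1].
pose F3 := splice_words B n.+2 [:: N; 1] [::].
pose F4 := splice_words (1 :: iota 3 n.+1) n.+2 [:: N; 2] [::].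
pose w0 := iota 2 n.+1 ++ [:: n.+3; 1; N].
(* The last two letters tell the families apart. *)
pose ends w a b := nth 0 w n.+2 = a /\ nth 0 w n.+3 = b.
have uB : uniq B by rewrite iota_uniq.
have sB : size B = n.+2 by rewrite size_iota.
have B_split r : perm_eq r B -> exists s b,
    [/\ r = s ++ [:: b], size s = n.+1, 1 < b < N & all (fun x => 1 < x < N) s].
  move=> pr; have : all (fun x => 1 < x < N) r.
    by rewrite (perm_all _ pr); apply/allP=> x; rewrite mem_iota; lia.
  have := perm_size pr; rewrite sB; case/lastP: r pr => // s b _.
  rewrite size_rcons all_rcons => -[sz] /andP[bN sN]; exists s, b.
  by rewrite cats1.
have nth_s s t i : size s = n.+1 -> nth 0 (s ++ t) (i + n.+1) = nth 0 t i.
  by move=> <-; rewrite nth_cat ltnNge leq_addl addnK.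
have E1 w : w \in F1 -> exists2 b, 1 < b < N & ends w 1 b.
  case/splice_wordsP=> r /B_split[s [b [-> sz bN _]]] ->; exists b => //.
  by rewrite take_size_cat // drop_size_cat // /ends (nth_s _ _ 1) // (nth_s _ _ 2).
have E2 w : w \in F2 -> exists2 b, 1 < b < N & ends w b 1.
  case/splice_wordsP=> r /B_split[s [b [-> sz bN _]]] ->; exists b => //.
  by rewrite take_size_cat // drop_size_cat // /ends (nth_s _ _ 1) // (nth_s _ _ 2).
have E3 w : w \in F3 -> ends w N 1.
  case/splice_wordsP=> r pr ->; have sr := perm_size pr; rewrite sB in sr.
  rewrite take_oversize ?drop_oversize ?sr //= /ends !nth_cat sr.
  by rewrite ltnn subnn ltnNge leqnSn subSnn.
have E4 w : w \in F4 -> ends w N 2.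
  case/splice_wordsP=> r pr ->; have sr := perm_size pr; rewrite /= size_iota in sr.
  rewrite take_oversize ?drop_oversize ?sr //= /ends !nth_cat sr.
  by rewrite ltnn subnn ltnNge leqnSn subSnn.
have E0 : ends w0 1 N.
  by rewrite /ends /w0 (nth_s _ _ 1) ?(nth_s _ _ 2) ?size_iota.
have disj (X Y : seq (seq nat)) :
    (forall w, w \in X -> w \in Y -> False) -> ~~ has (mem X) Y.
  by move=> XY; apply/hasPn => w wY; apply/negP => /XY; apply.
have u4 : uniq (1 :: iota 3 n.+1) by rewrite cons_uniq mem_iota iota_uniq.
have s4 : size (1 :: iota 3 n.+1) = n.+2 by rewrite /= size_iota.
have uniqF : uniq (w0 :: F1 ++ F2 ++ F3 ++ F4).
  rewrite cons_uniq !cat_uniq !splice_words_uniq ?sB ?s4 //=.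
  rewrite !andbT; apply/and4P; split.
  - rewrite !mem_cat; apply/negP => /or4P[/E1[b bN]|/E2[b bN]|/E3|/E4];
      move: E0; rewrite /ends; lia.
  - apply: disj => w /E1[b bN e]; rewrite !mem_cat.
    by case/or3P=> [/E2[c cN]|/E3|/E4]; move: e; rewrite /ends; lia.
  - apply: disj => w /E2[b bN e]; rewrite mem_cat.
    by case/orP=> [/E3|/E4]; move: e; rewrite /ends; lia.
  - by apply: disj => w /E3 e /E4; move: e; rewrite /ends; lia.
have sF : size (w0 :: F1 ++ F2 ++ F3 ++ F4) = (4 * n.+2`!).+1.
  rewrite -cat1s !size_cat !size_splice_words // sB s4 -[size [:: w0]]/1; lia.
apply: leq_trans (size_le_word_count _ _ _ uniqF _); first by rewrite sF.
move=> w.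
have p1 : perm_eq ([:: N; 1] ++ B) (iota 1 N) := perm_iota_lo_hi n.+2.
have gt1_r r x : perm_eq r B -> x \in r -> 1 < x < N.
  by move=> pr; rewrite (perm_mem pr) mem_iota; lia.
rewrite inE !mem_cat => /or4P[/eqP->|wF1|wF2|].
- have pw : perm_eq w0 (iota 1 N).
    rewrite /w0 -[[:: n.+3; 1; N]]/([:: n.+3] ++ [:: 1] ++ [:: N]) catA perm_catCA.
    have -> : iota 1 N = 1 :: iota 2 (n.+1 + 2) by rewrite addn2.
    by rewrite iotaD -catA.
  split=> //; apply: (delayed_unsorted 1 N _ n.+1) => //.
  exists (iota 2 n.+1), n.+3, [:: N]; split=> //.
    by apply/allP => x; rewrite mem_iota; lia.
  rewrite -[RHS](size_iota 2); apply/eqP; rewrite -all_count.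
  by apply/allP => x; rewrite mem_iota; lia.
- have [r pr ew] := splice_wordsP _ _ _ _ _ wF1.
  have pw : perm_eq w (iota 1 N) by rewrite ew;
      exact: (perm_splice _ _ _ [:: N; 1] [::] _ pr p1).
  split=> //; apply: (delayed_unsorted 1 N _ n.+1) => //.
  have [s [b [er sz bN sN]]] := B_split r pr.
  exists s, N, [:: b]; split=> //.
  + by rewrite ew er take_size_cat // drop_size_cat.
  + by apply: sub_all sN => x /andP[].
  + by rewrite /=; case/andP: bN => ->.
  + by rewrite -sz; apply/eqP; rewrite -all_count; apply: sub_all sN => x /andP[].
- have [r pr ew] := splice_wordsP _ _ _ _ _ wF2.
  have pw : perm_eq w (iota 1 N) by rewrite ew;
      exact: (perm_splice _ _ _ [:: N] [:: 1] _ pr p1).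
  split=> //; rewrite iterSr.
  have uw : uniq w by rewrite (perm_uniq pw) iota_uniq.
  apply: (delayed_unsorted 1 N _ n) => //.
    exact: perm_trans (perm_stack_sort _ uw) pw.
  have [s [b [er sz bN sN]]] := B_split r pr.
  have ew' : w = s ++ N :: [:: b; 1].
    by rewrite ew er take_size_cat // drop_size_cat.
  have us : uniq s by move: uw; rewrite ew' cat_uniq => /andP[].
  have [|u [m [es um]]] := stack_sort_last_max s us; first by case: (s) sz.
  have ps := perm_stack_sort s us; rewrite es in ps.
  have sz' : size u = n by move: (perm_size ps); rewrite size_rcons sz => -[].
  have um1 : all (fun x => 1 < x < N) (rcons u m) by rewrite (perm_all _ ps).
  move: um1; rewrite all_rcons => /andP[/andP[m1 _] u1].
  exists u, m, [:: b; N]; split=> //.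
  + rewrite ew' stack_sort_cat; last first.
      rewrite all_cat /= andbT; case/andP: bN => _ ->; rewrite andbT.
      by apply: sub_all sN => x /andP[].
    rewrite es (_ : stack_sort [:: b; 1] = [:: 1; b]) ?cat_rcons //.
    rewrite -[[:: b; 1]]/([::] ++ b :: [:: 1]).
    by rewrite stack_sort_cat //= andbT; case/andP: bN.
  + by rewrite /= andbT; case/andP: bN => ->.
  + by rewrite -sz'; apply/eqP; rewrite -all_count; apply: sub_all u1 => x /andP[].
case/orP=> wF.
- have [r pr ew] := splice_wordsP _ _ _ _ _ wF.
  have pw : perm_eq w (iota 1 N) by rewrite ew;
      exact: (perm_splice _ _ _ [:: N; 1] [::] _ pr p1).
  split=> //; apply: (delayed_unsorted 1 N _ n.+2) => //.
  have sr := perm_size pr; rewrite sB in sr.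
  exists r, N, [::]; split=> //.
  + by rewrite ew take_oversize ?drop_oversize ?sr.
  + by apply/allP => x /(gt1_r _ _ pr)/andP[].
  + by rewrite -sr; apply/eqP; rewrite -all_count; apply/allP => x /(gt1_r _ _ pr)/andP[].
- have [r pr ew] := splice_wordsP _ _ _ _ _ wF.
  have pw : perm_eq w (iota 1 N).
    rewrite ew; apply: (perm_splice _ _ _ [:: N; 2] [::] _ pr); apply: perm_trans p1.
    by rewrite /= perm_cons (perm_catCA [:: 2] [:: 1]).
  split=> //; apply: (delayed_unsorted 2 N _ n.+1) => //.
  have sr := perm_size pr; rewrite /= size_iota in sr.
  exists r, N, [::]; split=> //.
  + by rewrite ew take_oversize ?drop_oversize ?sr.
  + by rewrite (perm_all _ pr) /=; apply/allP => x; rewrite mem_iota; lia.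
  + rewrite (seq.permP pr) -cat1s count_cat add0n -[RHS](size_iota 3).
    apply/eqP; rewrite -all_count.
    by apply/allP => x; rewrite mem_iota; lia.
Qed.

(** * Words that stay unsorted under revstack sort *)

(** The empty word qualifies, whatever the default value of [last]: this is
    what allows an empty side in a decomposition at the maximum. *)
Definition ends_max (w : seq nat) : Prop := {in w, forall x, x <= last 0 w}.

Lemma ends_max_revstack w : uniq w -> ends_max (revstack_sort w).
Proof.
move=> uw x; rewrite (perm_mem (perm_revstack_sort w uw)).
have [->//|w0] := eqVneq w [::].
have [L [m [R [-> lt_m]]]] := max_split w uw w0.
rewrite revstack_sort_cat // catA last_cat mem_cat inE orbCA -mem_cat.
by case/orP=> [/eqP->//|/(allP lt_m)/ltnW].
Qed.

(** A part of the word that contains the overall maximum [m] and ends with its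
    own maximum must end with [m]. *)
Lemma cut_at_max s u v A m B : s ++ u ++ v = A ++ m :: B ->
  uniq (A ++ m :: B) -> all (fun x => x < m) (A ++ B) ->
  ends_max u -> m \in u -> s ++ u = A ++ [:: m] /\ v = B.
Proof.
move=> e uw lt_m eu mu; have m_le := eu m mu.
case/lastP: u mu eu m_le e => // u x mu eu; rewrite last_rcons => m_le e.
have xm : x = m.
  apply/eqP; rewrite eqn_leq m_le andbT.
  have : x \in A ++ m :: B by rewrite -e !mem_cat mem_rcons mem_head orbT.
  by rewrite mem_cat inE orbCA -mem_cat => /orP[/eqP->//|/(allP lt_m)/ltnW].
have e' : (s ++ u) ++ m :: v = A ++ m :: B by rewrite -e -xm cat_rcons catA.
have mA : m \notin A by move: uw; rewrite uniq_split mem_cat negb_or => /andP[/andP[]].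
have ms : m \notin s ++ u.
  by apply: contraTN uw => m_su; rewrite -e' uniq_split mem_cat m_su.
by have [<- <-] := cat_cons_inj ms mA e'; rewrite xm -cats1 catA.
Qed.

Lemma cut_two_at_max u v A m B : u ++ v = A ++ m :: B -> B != [::] ->
  uniq (A ++ m :: B) -> all (fun x => x < m) (A ++ B) ->
  ends_max u -> ends_max v -> u = A ++ [:: m] /\ v = B.
Proof.
move=> e B0 uw lt_m eu ev.
have : m \in u ++ v by rewrite e mem_cat mem_head orbT.
rewrite mem_cat => /orP[mu|mv].
  exact: (cut_at_max [::] u v A m B).
have [|_ B_nil] := cut_at_max u v [::] A m B _ uw lt_m ev mv.
  by rewrite cats0.
by rewrite -B_nil in B0.
Qed.

Lemma revstack_sort_split w m : uniq w -> m \in w -> {in w, forall x, x <= m} ->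
  exists L R, w = L ++ m :: R /\
    revstack_sort w = (revstack_sort R ++ revstack_sort L) ++ [:: m].
Proof.
move=> uw mw le_m; case/splitPr: mw uw le_m => L R uw le_m; exists L, R; split=> //.
rewrite revstack_sort_cat ?catA //; apply/allP=> x xLR.
rewrite ltn_neqAle le_m ?andbT.
  by apply: contraTneq uw => xm; rewrite uniq_split -xm xLR.
by rewrite mem_cat inE orbCA -mem_cat xLR orbT.
Qed.

Lemma iota1_cat n : iota 1 n.+1 = iota 1 n ++ [:: n.+1].
Proof. by rewrite -{1}(addn1 n) iotaD. Qed.

Lemma perm_word_del n L R : perm_eq (L ++ n.+1 :: R) (iota 1 n.+1) ->
  perm_eq (L ++ R) (iota 1 n).
Proof.
move=> pw; rewrite -(perm_cons n.+1); apply: (@perm_trans _ (L ++ n.+1 :: R)).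
  by rewrite perm_sym (perm_catCA L [:: n.+1] R).
by apply: (perm_trans pw); rewrite iota1_cat perm_catC.
Qed.

Lemma word_split n w : perm_eq w (iota 1 n.+1) ->
  exists L R, [/\ w = L ++ n.+1 :: R, perm_eq (L ++ R) (iota 1 n) &
    revstack_sort w = (revstack_sort R ++ revstack_sort L) ++ [:: n.+1]].
Proof.
move=> pw; have uw : uniq w by rewrite (perm_uniq pw) iota_uniq.
have [||L [R [ew eT]]] := revstack_sort_split w n.+1 uw.
- by rewrite (perm_mem pw) mem_iota; lia.
- by move=> x; rewrite (perm_mem pw) mem_iota; lia.
exists L, R; split=> //.
by apply: perm_word_del; rewrite -ew.
Qed.

Lemma iter_revstack_sort_cat k u m : uniq u -> all (fun x => x < m) u ->
  iter k revstack_sort (u ++ [:: m]) = iter k revstack_sort u ++ [:: m].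
Proof.
elim: k u => // k IH u uu um; rewrite !iterSr.
rewrite revstack_sort_cat ?cats0 // -IH.
- by [].
- by rewrite (perm_uniq (perm_revstack_sort u uu)).
- by rewrite (perm_all _ (perm_revstack_sort u uu)).
Qed.

Lemma iter_revstack_word k n w : perm_eq w (iota 1 n.+1) ->
  exists L R, [/\ w = L ++ n.+1 :: R, perm_eq (L ++ R) (iota 1 n),
    perm_eq (revstack_sort R ++ revstack_sort L) (iota 1 n) &
    iter k.+1 revstack_sort w =
    iter k revstack_sort (revstack_sort R ++ revstack_sort L) ++ [:: n.+1]].
Proof.
move=> pw; have [L [R [ew pLR eT]]] := word_split n w pw.
have uLR : uniq (L ++ R) by rewrite (perm_uniq pLR) iota_uniq.
have [uL uR] : uniq L /\ uniq R by move: uLR; rewrite cat_uniq => /and3P[].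
have pT : perm_eq (revstack_sort R ++ revstack_sort L) (iota 1 n).
  rewrite perm_catC; apply: perm_trans pLR.
  by rewrite perm_cat ?perm_revstack_sort.
exists L, R; split=> //; rewrite iterSr eT iter_revstack_sort_cat //.
  by rewrite (perm_uniq pT) iota_uniq.
by rewrite (perm_all _ pT); apply/allP => x; rewrite mem_iota; lia.
Qed.

(** Each pass puts one more of the largest letters in place. *)
Lemma iter_revstack_sort_id n w : perm_eq w (iota 1 n.+1) ->
  iter n revstack_sort w = iota 1 n.+1.
Proof.
elim: n w => [|n IH] w pw; first exact: perm_small_eq pw.
have [L [R [_ _ pT ->]]] := iter_revstack_word n n.+1 w pw.
by rewrite IH // -iota1_cat.
Qed.

Definition parity_split (n : nat) (w : seq nat) : Prop :=
  exists L R, [/\ w = L ++ n :: R, all (fun x => odd x == odd n) L &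
    all (fun x => odd x != odd n) R].

(** The letter just below the maximum has the wrong parity for [A]. *)
Lemma parity_split_right n A B : perm_eq (A ++ n.+2 :: B) (iota 1 n.+2) ->
  all (fun x => odd x == odd n.+2) A -> B != [::].
Proof.
move=> pw eA; have : n.+1 \in A ++ n.+2 :: B.
  by rewrite (perm_mem pw) mem_iota; lia.
rewrite mem_cat inE => /or3P[/(allP eA)||]; [lia|lia|by case: (B)].
Qed.

Lemma word_split_facts n A B : perm_eq (A ++ n.+1 :: B) (iota 1 n.+1) ->
  uniq (A ++ n.+1 :: B) /\ all (fun x => x < n.+1) (A ++ B).
Proof.
move=> pw; have uw : uniq (A ++ n.+1 :: B) by rewrite (perm_uniq pw) iota_uniq.
split=> //; apply/allP=> x xAB.
have : x \in A ++ n.+1 :: B by rewrite mem_cat inE orbCA -mem_cat xAB orbT.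
rewrite (perm_mem pw) mem_iota add1n ltnS => /andP[_ x_le]; rewrite ltn_neqAle x_le andbT.
by apply: contraTneq uw => xn; rewrite uniq_split -xn xAB.
Qed.

Lemma filter_split (p : pred nat) L R s : perm_eq (L ++ R) s ->
  all p L -> all (predC p) R -> perm_eq L (filter p s).
Proof.
move=> pLR pL pR; apply: (@perm_trans _ (filter p (L ++ R))); last exact: perm_filter.
rewrite filter_cat (all_filterP pL) (_ : filter p R = [::]) ?cats0 //.
by apply/eqP; rewrite -(negbK (_ == _)) -has_filter -all_predC.
Qed.

Lemma all_parityS_eq n w : all (fun x => odd x == odd n) w ->
  all (fun x => odd x != odd n.+1) w.
Proof. by apply: sub_all => x /eqP->; rewrite /=; case: (odd n). Qed.

Lemma all_parityS_neq n w : all (fun x => odd x != odd n) w ->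
  all (fun x => odd x == odd n.+1) w.
Proof. by apply: sub_all => x /=; case: (odd x); case: (odd n). Qed.

(** Going back by one pass exchanges the two sides and adds the old maximum to
    the right one, and the parity of the maximum changes too: the shape is
    reproduced. *)
Lemma parity_split_next n A B L R :
  all (fun x => odd x == odd n) A -> all (fun x => odd x != odd n) B ->
  perm_eq L B -> perm_eq R (A ++ [:: n]) -> parity_split n.+1 (L ++ n.+1 :: R).
Proof.
move=> eA eB pL pR; exists L, R; split=> //.
  by rewrite (perm_all _ pL); exact: all_parityS_neq.
rewrite (perm_all _ pR) all_cat all_parityS_eq //=.
by case: (odd n).
Qed.

Lemma parity_split_unsorted n w : perm_eq w (iota 1 n.+2) ->
  iter n revstack_sort w != iota 1 n.+2 -> parity_split n.+2 w.
Proof.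
elim: n w => [|n IH] w pw.
  move: pw; rewrite -mem_permutations 
    (_ : permutations _ = [:: [:: 1; 2]; [:: 2; 1]]) //.
  by rewrite !inE => /orP[]/eqP-> //; exists [::], [:: 1].
have [L [R [ew pLR pT ->]]] := iter_revstack_word n n.+2 w pw.
rewrite (iota1_cat n.+2) !cats1 eqseq_rcons.
rewrite eqxx andbT => /(IH _ pT)[A [B [eAB eA eB]]].
rewrite eAB in pT; have [uAB lt_AB] := word_split_facts _ _ _ pT.
have B0 := parity_split_right _ _ _ pT eA.
have [uL uR] : uniq L /\ uniq R.
  by apply/andP; have : uniq (L ++ R);
     [rewrite (perm_uniq pLR) iota_uniq | rewrite cat_uniq => /and3P[-> _ ->]].
have [eTR eTL] := cut_two_at_max _ _ _ _ _ eAB B0 uAB lt_AB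
  (ends_max_revstack _ uR) (ends_max_revstack _ uL).
rewrite ew; apply: (parity_split_next _ A B L R eA eB).
  by rewrite -eTL perm_sym perm_revstack_sort.
by rewrite -eTR perm_sym perm_revstack_sort.
Qed.

Definition parity_class (n : nat) : seq nat :=
  [seq x <- iota 1 n | odd x == odd n].

Definition complement (n : nat) (X : seq nat) : seq nat :=
  [seq x <- iota 1 n | x \notin X].

(** Candidates for the set of letters to the left of the maximum [k.+3] in a
    word that [k] passes leave unsorted.  Going back by one pass replaces a left
    set by its complement, the old right side; the first set of each list is the
    one that arises anew, when the image of the word, without its last letter,
    again ends with its maximum. *)
Fixpoint left_sets (k : nat) : seq (seq nat) :=
  if k is k'.+1 then
    parity_class k'.+3 :: [seq complement k'.+2 X | X <- left_sets k']
  else [:: [:: 2]; [:: 1]; [::]].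

Lemma left_setsS k : left_sets k.+1 =
  parity_class k.+3 :: [seq complement k.+2 X | X <- left_sets k].
Proof. by []. Qed.

Lemma parity_class_left_sets k : parity_class k.+2 \in left_sets k.
Proof. by case: k => [|k]; rewrite /= mem_head. Qed.

Lemma complement_left_sets k X :
  X \in left_sets k -> complement k.+2 X \in left_sets k.+1.
Proof. by move=> X_in; rewrite /= inE map_f ?orbT. Qed.

Definition near_split (k : nat) (w : seq nat) : Prop :=
  (exists L R X, [/\ w = L ++ k.+3 :: R, X \in left_sets k & perm_eq L X]) \/
  (exists L R, w = L ++ k.+3 :: R /\ parity_split k.+2 (L ++ R)).

(** Backward induction on the number of passes.  Let [L' ++ k.+3 :: R'] be the
    image [w] has after one pass, without its last letter.  If [R'] is empty,
    [L'] is a word to which [parity_split_unsorted] applies, and [L'] is cut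
    into the images of two or three parts of [w]; the part that contains [k.+2],
    the maximum of [L'], ends there, and each case gives one alternative of the
    conclusion.  If [R'] is not empty, [L] and [R] are determined by [R'] and
    [L'] up to the order of their letters, and either alternative for the image
    leads to one for [w]. *)
Lemma near_split_unsorted k w : perm_eq w (iota 1 k.+3) ->
  iter k revstack_sort w != iota 1 k.+3 -> near_split k w.
Proof.
elim: k w => [|k IH] w pw.
  move: pw; rewrite -mem_permutations (_ : permutations _ = [::
    [:: 2; 1; 3]; [:: 1; 2; 3]; [:: 3; 1; 2]; [:: 1; 3; 2]; [:: 2; 3; 1]; [:: 3; 2; 1]]) //.
  have p21 : parity_split 2 [:: 2; 1] by exists [::], [:: 1].
  rewrite !inE => /or4P[|||/or3P[]] /eqP-> //= _.
  - by right; exists [:: 2; 1], [::].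
  - by left; exists [::], [:: 1; 2], [::].
  - by left; exists [:: 1], [:: 2], [:: 1].
  - by right; exists [:: 2], [:: 1].
  - by right; exists [::], [:: 2; 1].
have [L [R [ew pLR pT ->]]] := iter_revstack_word k k.+3 w pw.
rewrite (iota1_cat k.+3) !cats1 eqseq_rcons.
rewrite eqxx andbT => unsorted.
have uLR : uniq (L ++ R) by rewrite (perm_uniq pLR) iota_uniq.
have [uL uR] : uniq L /\ uniq R by move: uLR; rewrite cat_uniq => /and3P[].
have [eL eR] := (ends_max_revstack _ uL, ends_max_revstack _ uR).
have [pL pR] := (perm_revstack_sort _ uL, perm_revstack_sort _ uR).
have [L' [R' eT]] : exists L' R',
    revstack_sort R ++ revstack_sort L = L' ++ k.+3 :: R'.
  by case: (IH _ pT unsorted) => [[L' [R' [X []]]]|[L' [R' []]]]; exists L', R'.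
have pT' := pT; rewrite eT in pT'; have [uT' lt_T'] := word_split_facts _ _ _ pT'.
have pLR' := perm_word_del _ _ _ pT'.
have le_max x : x \in L ++ R -> x <= k.+3.
  by rewrite (perm_mem pLR) mem_iota add1n ltnS => /andP[].
have nLR : k.+3 \in L ++ R by rewrite (perm_mem pLR) mem_iota add1n leqnn.
have [R'_nil|R'0] := eqVneq R' [::].
  rewrite R'_nil cats0 in eT pLR'.
  have : iter k revstack_sort L' != iota 1 k.+2.
    move: unsorted; rewrite eT (iota1_cat k.+2) iter_revstack_sort_cat.
    - by rewrite !cats1 eqseq_rcons eqxx andbT.
    - by rewrite (perm_uniq pLR') iota_uniq.
    - by move: lt_T'; rewrite R'_nil cats0.
  move/(parity_split_unsorted _ _ pLR') => [A [B [eAB eA eB]]].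
  rewrite eAB in pLR' eT; have [uAB lt_AB] := word_split_facts _ _ _ pLR'.
  have B0 := parity_split_right _ _ _ pLR' eA.
  (* The maximum [k.+3] comes last in the image, so it is the maximum of [R] if
     [L] is empty, and the maximum of [L] otherwise. *)
  have [L_nil|L0] := eqVneq L [::].
    have [||R1 [R2 [eR12 eTR]]] := revstack_sort_split R k.+3 uR.
    + by rewrite L_nil in nLR.
    + by move=> x xR; apply: le_max; rewrite mem_cat xR orbT.
    have [uR1 uR2] : uniq R1 /\ uniq R2.
      by apply: (@uniq_sides _ _ k.+3); rewrite -eR12.
    move: eT; rewrite L_nil cats0 eTR !cats1 => /rcons_inj[eT].
    have [eT2 eT1] := cut_two_at_max _ _ _ _ _ eT B0 uAB lt_AB
      (ends_max_revstack _ uR2) (ends_max_revstack _ uR1).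
    right; exists [::], R; rewrite ew L_nil eR12; split=> //=.
    apply: (parity_split_next _ A B) => //.
      by rewrite -eT1 perm_sym perm_revstack_sort.
    by rewrite -eT2 perm_sym perm_revstack_sort.
  have nL : k.+3 \in L.
    rewrite -(perm_mem pL); move: (perm_size pL) eT.
    case/lastP: (revstack_sort L) => [|s x _]; first by case: (L) L0.
    by rewrite -rcons_cat !cats1 => /rcons_inj[_ ->]; rewrite mem_rcons mem_head.
  have [|L1 [L2 [eL12 eTL]]] := revstack_sort_split L k.+3 uL nL.
    by move=> x xL; apply: le_max; rewrite mem_cat xL.
  have [uL1 uL2] : uniq L1 /\ uniq L2.
    by apply: (@uniq_sides _ _ k.+3); rewrite -eL12.
  have [pL1 pL2] := (perm_revstack_sort _ uL1, perm_revstack_sort _ uL2).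
  move: eT; rewrite eTL catA !cats1 => /rcons_inj[eT].
  have : k.+2 \in revstack_sort R ++ (revstack_sort L2 ++ revstack_sort L1).
    by rewrite eT mem_cat mem_head orbT.
  rewrite !mem_cat => /or3P[mR|mL2|mL1].
  + have [/= eTR eTL12] := cut_at_max [::] _ _ _ _ _ eT uAB lt_AB eR mR.
    left; exists L, R, (parity_class k.+3); split=> //.
      exact: parity_class_left_sets k.+1.
    apply: (filter_split _ _ R) => //.
      by rewrite -(perm_all _ pL) eTL eTL12 all_cat (all_parityS_neq _ _ eB) /= eqxx.
    rewrite -(perm_all _ pR) eTR all_cat (all_parityS_eq _ _ eA) /= andbT.
    by case: (odd k).
  + have [eTR eT1] := cut_at_max _ _ _ _ _ _ eT uAB lt_AB (ends_max_revstack _ uL2) mL2.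
    right; exists L, R; rewrite ew; split=> //; rewrite eL12 -catA /=.
    apply: (parity_split_next _ A B) => //; first by rewrite -eT1 perm_sym.
    by rewrite -eTR perm_catC perm_sym perm_cat.
  + have [|_ B_nil] := cut_at_max (revstack_sort R ++ revstack_sort L2) _ [::] _ _ _ _
      uAB lt_AB (ends_max_revstack _ uL1) mL1; first by rewrite cats0 -catA.
    by rewrite -B_nil in B0.
have [eTR eTL] := cut_two_at_max _ _ _ _ _ eT R'0 uT' lt_T' eR eL.
have pLR'' : perm_eq L R' by rewrite -eTL perm_sym.
case: (IH _ pT unsorted) => [[L1 [S1 [X [e1 X_in pX]]]]|[L1 [S1 [e1]]]].
  have [eL1 _] := uniq_cat_cons_inj uT' (etrans (esym eT) e1).
  rewrite -eL1 in pX.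
  left; exists L, R, (complement k.+2 X); split=> //; first exact: complement_left_sets.
  apply: (perm_trans pLR''); apply: (filter_split (fun x => x \notin X) _ L').
  - by rewrite perm_catC.
  - have : uniq (L' ++ R') by rewrite (perm_uniq pLR') iota_uniq.
    rewrite cat_uniq => /and3P[_ /hasPn R'_L' _]; apply/allP=> x /R'_L'.
    by rewrite /= (perm_mem pX).
  - by apply/allP=> x; rewrite /= negbK (perm_mem pX).
case=> A [B [eAB eA eB]].
have [eL1 eR1] := uniq_cat_cons_inj uT' (etrans (esym eT) e1).
rewrite -eL1 -eR1 in eAB.
have pAB := pLR'; rewrite eAB in pAB; have [uAB lt_AB] := word_split_facts _ _ _ pAB.
have B0 := parity_split_right _ _ _ pAB eA.
(* The image without its maximum has the shape [A ++ k.+2 :: B].  Since [B] is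
   nonempty and [R'] ends with its maximum, [k.+2] lies in [L']. *)
have : k.+2 \in L' ++ R' by rewrite eAB mem_cat mem_head orbT.
rewrite mem_cat => /orP[mL'|mR']; last first.
  have [||_ B_nil] := cut_at_max L' R' [::] _ _ _ _ uAB lt_AB _ mR'.
  - by rewrite cats0.
  - by rewrite -eTL.
  - by rewrite -B_nil in B0.
case/splitPr: mL' => A' B' in eAB eTR pLR' *.
rewrite -catA /= in eAB.
have [eA' eB'] := uniq_cat_cons_inj uAB (esym eAB).
rewrite -eA' in eTR pLR'; clear A' eA' eAB.
have [B'_nil|B'0] := eqVneq B' [::].
  left; exists L, R, (complement k.+2 (parity_class k.+2)); split=> //.
    exact/complement_left_sets/parity_class_left_sets.
  rewrite B'_nil in pLR' eB'.
  apply: (perm_trans pLR''); apply: (filter_split _ _ (A ++ [:: k.+2])).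
  - by rewrite perm_catC.
  - rewrite -[R']eB'; apply: sub_all eB => x /=.
    by rewrite mem_filter => /negPf->.
  - apply/allP=> x xA; rewrite /= negbK mem_filter -(perm_mem pLR') mem_cat xA andbT.
    by move: xA; rewrite mem_cat inE => /orP[/(allP eA)|/eqP->].
(* Both parts [B'] and [R'] of [B] are nonempty.  One more step back, inside
   [R], shows that [B'] comes from the letters of [R] before [k.+3]. *)
have nR : k.+3 \in R by rewrite -(perm_mem pR) eTR mem_cat mem_head orbT.
have [|R1 [R2 [eR12 eTR12]]] := revstack_sort_split R k.+3 uR nR.
  by move=> x xR; apply: le_max; rewrite mem_cat xR orbT.
have [uR1 uR2] : uniq R1 /\ uniq R2.
  by apply: (@uniq_sides _ _ k.+3); rewrite -eR12.
move: eTR; rewrite eTR12 !cats1 => /rcons_inj[eT12].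
have [uAB' lt_AB'] : uniq (A ++ k.+2 :: B') /\ all (fun x => x < k.+2) (A ++ B').
  split.
    have : uniq ((A ++ k.+2 :: B') ++ R') by rewrite (perm_uniq pLR') iota_uniq.
    by rewrite cat_uniq => /and3P[].
  by move: lt_AB; rewrite eB' catA all_cat => /andP[].
have [eT2 eT1] := cut_two_at_max _ _ _ _ _ eT12 B'0 uAB' lt_AB'
  (ends_max_revstack _ uR2) (ends_max_revstack _ uR1).
right; exists L, R; rewrite ew; split=> //; rewrite eR12 catA.
apply: (parity_split_next _ A B) => //.
  by rewrite eB' perm_catC perm_cat // -eT1 perm_sym perm_revstack_sort.
by rewrite -eT2 perm_sym perm_revstack_sort.
Qed.

(** * The number of words left unsorted by revstack sort *)

Definition blocks (m : nat) (X Y : seq nat) : seq (seq nat) :=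
  [seq l ++ m :: r | l <- permutations X, r <- permutations Y].

Lemma mem_blocks m X Y L R : perm_eq L X -> perm_eq R Y ->
  L ++ m :: R \in blocks m X Y.
Proof.
move=> pL pR; apply: (allpairs_f (fun l r => l ++ m :: r));
  by rewrite mem_permutations.
Qed.

(** Distributing a fixed number of letters over two blocks with at least two
    letters each, the most unbalanced distribution has the most arrangements. *)
Lemma leq_fact_mul2 a b : 2 <= a -> 2 <= b -> a`! * b`! <= 2 * (a + b - 2)`!.
Proof.
case: a => [|[|a]] // _; case: b => [|[|b]] // _.
rewrite addSn addSn subSS subSS subn0.
elim: a => [|a IH]; first by rewrite add0n.
rewrite [a.+3`!]factS -mulnA addSn [(a + _).+1`!]factS [X in _ <= X]mulnCA.
by apply: leq_mul => //; lia.
Qed.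

Lemma size_blocks m X Y : uniq X -> uniq Y -> 2 <= size X -> 2 <= size Y ->
  size (blocks m X Y) <= 2 * (size X + size Y - 2)`!.
Proof.
move=> uX uY X2 Y2; rewrite size_allpairs !size_permutations //.
exact: leq_fact_mul2.
Qed.

Lemma parity_count n b : 2 <= count (fun x => odd x == b) (iota 1 n.+4).
Proof. by rewrite /=; case: b => /=; lia. Qed.

Lemma parityC_count n b : 2 <= count (fun x => odd x != b) (iota 1 n.+4).
Proof. by rewrite /=; case: b => /=; lia. Qed.

Definition parity_words (n : nat) : seq (seq nat) :=
  blocks n.+1 [seq x <- iota 1 n | odd x == odd n.+1]
    [seq x <- iota 1 n | odd x != odd n.+1].

Lemma mem_parity_words n w : perm_eq w (iota 1 n.+1) ->
  parity_split n.+1 w -> w \in parity_words n.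
Proof.
move=> pw [L [R [ew eL eR]]]; rewrite ew in pw *.
have pLR := perm_word_del _ _ _ pw.
apply: mem_blocks; first exact: (filter_split _ _ R).
apply: (filter_split _ _ L) => //; first by rewrite perm_catC.
by apply: sub_all eL => x /= ->.
Qed.

Lemma size_parity_words n : size (parity_words n.+4) <= 2 * n.+2`!.
Proof.
apply: leq_trans (size_blocks _ _ _ _ _ _ _) _.
- by rewrite filter_uniq ?iota_uniq.
- by rewrite filter_uniq ?iota_uniq.
- by rewrite size_filter parity_count.
- by rewrite size_filter parityC_count.
rewrite !size_filter; set p := (X in count X _).
rewrite (_ : count _ _ + count _ _ = n.+4) ?subSS ?subn0 //.
by rewrite -[RHS](size_iota 1) -(count_predC p).
Qed.

Lemma unsorted_revstack_lt_fact n :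
  word_count n.+1.+4 (fun w => iter n.+3 revstack_sort w != iota 1 n.+1.+4) < n.+3`!.
Proof.
apply: (@leq_ltn_trans (2 * n.+2`!)); last by rewrite [n.+3`!]factS ltn_pmul2r ?fact_gt0.
apply: leq_trans (size_parity_words n).
apply: word_count_le_size => w pw unsorted.
exact/mem_parity_words/parity_split_unsorted.
Qed.

Lemma size_complement n X : uniq X -> all (mem (iota 1 n)) X ->
  size X + size (complement n X) = n.
Proof.
move=> uX /allP X_in; rewrite size_filter -[RHS](size_iota 1).
rewrite -(count_predC (mem X) (iota 1 n)).
congr (_ + _); rewrite -size_filter; apply: perm_size; apply: uniq_perm => //.
  by rewrite filter_uniq ?iota_uniq.
move=> x; rewrite mem_filter /=.
by case: (boolP (x \in X)) => // /X_in.
Qed.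

(** From word length 6 on, both sides of the maximum have at least two letters;
    complements preserve this, and each parity class has at least two elements
    and misses at least two. *)
Lemma left_sets_bounds k X : X \in left_sets k.+3 ->
  [/\ uniq X, all (mem (iota 1 k.+1.+4)) X & 2 <= size X <= k.+3].
Proof.
move=> X_in; suff: all (fun X => [&& uniq X, all (mem (iota 1 k.+1.+4)) X &
  2 <= size X <= k.+3]) (left_sets k.+3) by move/allP/(_ X X_in)/and3P.
elim: k {X X_in} => [|k IH]; first by [].
rewrite left_setsS; set Xs := map _ _; rewrite -cat1s all_cat all_seq1.
apply/andP; split.
  rewrite filter_uniq ?iota_uniq // andTb; apply/andP; split.
    by apply/allP=> x; rewrite mem_filter => /andP[_].
  rewrite size_filter parity_count andTb; set p : pred nat := fun x => _.
  have := parityC_count k.+2 (odd k.+2.+4); rewrite -[count _ _]/(count (predC p) _).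
  have := count_predC p (iota 1 k.+2.+4); rewrite size_iota.
  by move: (count p _) (count (predC p) _) => c1 c2; lia.
apply/allP=> Y /mapP[X X_in ->]; rewrite {Xs Y}.
have /and3P[uX Xn Xk] := allP IH X X_in.
have sX := size_complement _ _ uX Xn; rewrite filter_uniq ?iota_uniq // andTb.
apply/andP; split; last by move: sX Xk; move: (size X) (size (complement _ _)) => a b; lia.
by apply/allP=> x; rewrite mem_filter !inE !mem_iota => /andP[_]; lia.
Qed.

Lemma size_flatten_leq (T : eqType) (ss : seq (seq T)) c :
  {in ss, forall s, size s <= c} -> size (flatten ss) <= size ss * c.
Proof.
elim: ss => //= s ss IH le_c; rewrite size_cat mulSn leq_add ?le_c ?mem_head //.
by apply: IH => t t_in; apply: le_c; rewrite inE t_in orbT.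
Qed.

Lemma size_left_sets k : size (left_sets k) = k + 3.
Proof. by elim: k => //= k IH; rewrite size_map IH. Qed.

Definition insertions (m n : nat) (ws : seq (seq nat)) : seq (seq nat) :=
  [seq take i w ++ m :: drop i w | w <- ws, i <- iota 0 n].

Lemma mem_insertions m n ws L R : L ++ R \in ws -> size L < n ->
  L ++ m :: R \in insertions m n ws.
Proof.
move=> w_in lt_n.
have := allpairs_f (fun w i => take i w ++ m :: drop i w) w_in
  (_ : size L \in iota 0 n).
by rewrite take_size_cat // drop_size_cat // mem_iota; apply.
Qed.

(** With [n = k + 6], the [n] left sets contribute at most [2 (n-3)!] words
    each, and inserting [n] anywhere into the at most [2 (n-4)!] words of the
    second kind gives [2 n (n-4)!]; the sum is at most [4 (n-2)!]
    since [2 n <= 4 (n-3)]. *)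
Lemma unsorted_revstack_le_fact k (n := k.+4.+2) :
  word_count n (fun w => iter k.+3 revstack_sort w != iota 1 n) <= 4 * k.+4`!.
Proof.
pose As := flatten [seq blocks n X (complement k.+1.+4 X) | X <- left_sets k.+3].
pose Bs := insertions n n (parity_words k.+4).
apply: (@leq_trans (size (As ++ Bs))).
  apply: word_count_le_size => w pw unsorted; rewrite mem_cat.
  case: (near_split_unsorted _ _ pw unsorted).
    case=> L [R [X [ew X_in pX]]].
    apply/orP; left; apply/flatten_mapP; exists X => //; rewrite ew in pw *.
    have [uX Xn _] := left_sets_bounds _ _ X_in.
    have pLR := perm_word_del _ _ _ pw.
    apply: mem_blocks => //; apply: (filter_split _ _ L); first by rewrite perm_catC.
      have : uniq (L ++ R) by rewrite (perm_uniq pLR) iota_uniq.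
      rewrite cat_uniq => /and3P[_ /hasPn R_L _]; apply/allP=> x /R_L.
      by rewrite /= (perm_mem pX).
    by apply/allP=> x; rewrite /= negbK (perm_mem pX).
  case=> L [R [ew eLR]]; apply/orP; right; rewrite ew in pw *.
  have pLR := perm_word_del _ _ _ pw.
  apply: mem_insertions; first exact: mem_parity_words.
  apply: (@leq_ltn_trans (size (L ++ R))); first by rewrite size_cat leq_addr.
  by rewrite (perm_size pLR) size_iota.
rewrite size_cat.
have leA : size As <= (k.+3 + 3) * (2 * k.+3`!).
  rewrite -size_left_sets.
  rewrite -(size_map (fun X => blocks n X (complement k.+1.+4 X)) (left_sets _)).
  apply: size_flatten_leq => s /mapP[X X_in ->].
  have [uX Xn /andP[X2 Xk]] := left_sets_bounds _ _ X_in.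
  have sX := size_complement _ _ uX Xn.
  apply: leq_trans (size_blocks _ _ _ _ _ _ _) _ => //.
  - by rewrite filter_uniq ?iota_uniq.
  - by rewrite -(leq_add2l (size X)) sX; lia.
  - by rewrite sX !subSS subn0.
have leB : size Bs <= 2 * k.+2`! * n.
  by rewrite size_allpairs size_iota leq_mul2r size_parity_words orbT.
apply: leq_trans (leq_add leA leB) _.
rewrite [k.+4`!]factS [k.+3`!]factS /n; nia.
Qed.

(** * Comparison of the numbers of sorted words *)

Lemma card_sorted_after f n k :
  #|sorted_after f n k| = word_count n (fun w => iter k f w == iota 1 n).
Proof. exact: card_word_count. Qed.

(** The sorted and the unsorted words together number [n!]. *)
Lemma ltn_sorted_after n k :
  word_count n (fun w => iter k revstack_sort w != iota 1 n) <
    word_count n (fun w => iter k stack_sort w != iota 1 n) ->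
  #|sorted_after stack_sort n k| < #|sorted_after revstack_sort n k|.
Proof.
rewrite !card_sorted_after => lt.
have := word_countC n (fun w => iter k revstack_sort w == iota 1 n).
rewrite -(word_countC n (fun w => iter k stack_sort w == iota 1 n)) => e.
by rewrite -(ltn_add2r (word_count n (fun w => iter k stack_sort w != iota 1 n)))
  -[X in X < _]e ltn_add2l.
Qed.

Theorem theorem4p1 (n k : nat) (n_ge3 : 3 <= n)
    (k_in : k \in [:: 0; 1; 2; n - 3; n - 2; n - 1]) :
  #|sorted_after stack_sort n k| <= #|sorted_after revstack_sort n k| /\
  (2 < k < n - 1 ->
   #|sorted_after stack_sort n k| < #|sorted_after revstack_sort n k|).
Proof.
have [k_le2|k_gt2] := leqP k 2.
  split=> //; rewrite !card_sorted_after; case: k k_le2 {k_in} => [|[|[|//]]] _.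
  - by [].
  - exact: word_count_sorted1.
  - exact: word_count_sorted2.
have [k_last|k_not_last] := eqVneq k (n - 1).
  split; last by rewrite k_last ltnn andbF.
  rewrite !card_sorted_after; apply: (leq_word_count _ _ _ id) => // w pw _.
  split=> //; rewrite k_last; case: n n_ge3 {k_in k_last} pw => // n _ pw.
  by rewrite subn1 iter_revstack_sort_id.
suff lt : #|sorted_after stack_sort n k| < #|sorted_after revstack_sort n k|.
  by split=> //; apply: ltnW.
apply: ltn_sorted_after.
have [-> | ->] : n = k.+3 \/ n = k.+2 by move: k_in; rewrite !inE; lia.
  case: k k_gt2 {k_in k_not_last} => [|[|[|k]]] // _.
  exact: leq_ltn_trans (unsorted_revstack_le_fact k) (unsorted_stack_gt_fact k.+2).
case: k k_gt2 {k_in k_not_last} => [|[|[|k]]] // _.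
exact: leq_trans (unsorted_revstack_lt_fact k) (unsorted_stack_ge_fact k.+3).
Qed.
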